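(* If $\mathfrak p$ is a height one prime ideal of a noetherian normal monoid $A$, then the localization $A_{\mathfrak p}$ is a discrete valuation monoid.
   Context: ''Monoid'' means commutative monoid $A$, written multiplicatively, with unit $1$ and a zero element $0$ satisfying $0a=0$. An ideal of $A$ is a subset $I\ni0$ with $AI\subseteq I$; a prime ideal is a proper ideal $\mathfrak p$ such that $xy\in\mathfrak p$ implies $x\in\mathfrak p$ or $y\in\mathfrak p$. $A_{\mathfrak p}$ is the localization inverting all elements of $A\setminus\mathfrak p$. The height of a prime is the supremum of lengths of chains of primes descending from it. $A$ is noetherian if it satisfies the ascending chain condition on ideals. A nonzero monoid $A$ is cancellative if $ab=ac$ with $a\ne0$ implies $b=c$; then it embeds in its group completion $A_0$ (obtained by inverting all nonzero elements), and $A_0^\times=A_0\setminus\{0\}$ is an abelian group. A cancellative monoid $A$ is normal if every $b\in A_0$ with $b^n\in A$ for some $n>0$ lies in $A$. A valuation monoid is a cancellative monoid $A$ such that for every nonzero $\alpha\in A_0$, either $\alpha\in A$ or $\alpha^{-1}\in A$; its value group is $A_0^\times/A^\times$. A discrete valuation monoid is a valuation monoid whose value group is infinite cyclic. *)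

(* Defs.v *)
From HB Require Import structures.
From mathcomp Require Import all_boot all_order.
From mathcomp Require Import boolp classical_sets cardinality.

Set Implicit Arguments.
Unset Strict Implicit.
Unset Printing Implicit Defensive.

Local Open Scope classical_set_scope.
Local Open Scope quotient_scope.
Local Open Scope group_scope.

(* Commutative monoids with an absorbing element [zerog]; the degenerate case  *)
(* zerog = 1 is allowed. [monoid.Monoid] is the algebraic structure, as opposed *)
(* to the module [bigop.Monoid] of operator laws.                              *)
HB.mixin Record Monoid_isPointedComMonoid A of monoid.Monoid A := {
  zerog : A;
  mulgC : commutative (@monoid.mul A);
  mul0g : left_zero zerog (@monoid.mul A)
}.

#[short(type="pcMonoidType")]
HB.structure Definition PointedComMonoid :=
  {A of Monoid_isPointedComMonoid A & monoid.Monoid A}.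

Arguments zerog {s}.

HB.instance Definition _ (A : pcMonoidType) :=
  SemiGroup.isCommutativeLaw.Build A (@monoid.mul A) mulgC.

Lemma mulg0 (A : pcMonoidType) : right_zero zerog (@monoid.mul A).
Proof. by move=> x; rewrite mulgC mul0g. Qed.

Section Ideals.
Variable A : pcMonoidType.
Implicit Types I p : set A.

Definition ideal I : Prop := I zerog /\ forall a x, I x -> I (a * x).

Definition prime_ideal p : Prop :=
  [/\ ideal p, p <> [set: A] & forall x y, p (x * y) -> p x \/ p y].

Definition prime_chain p (n : nat) : Prop :=
  exists q : nat -> set A,
    [/\ q 0%N = p, forall i, (i <= n)%N -> prime_ideal (q i)
      & forall i, (i < n)%N -> q i.+1 `<` q i].

(* The supremum of the lengths of the chains of primes descending from p is   *)
(* finite and equal to h; no h satisfies this when p has infinite height.      *)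
Definition has_height p (h : nat) : Prop :=
  supremums [set n | prime_chain p n] h.

Lemma prime_ideal1 p : prime_ideal p -> ~ p 1.
Proof.
move=> [[_ pM] pT _] p1; apply: pT; apply/seteqP; split=> // x _.
by rewrite -[x]mulg1; apply: pM.
Qed.

End Ideals.

Definition noetherian_monoid (A : pcMonoidType) : Prop :=
  forall I : nat -> set A, (forall n, ideal (I n)) ->
    (forall n, I n `<=` I n.+1) ->
    exists N, forall n, (N <= n)%N -> I n = I N.

Record cancellative (A : pcMonoidType) : Prop := Cancellative {
  cancellative_neq0 : (1 : A) <> zerog;
  cancellative_mulI : forall a b c : A, a <> zerog -> a * b = a * c -> b = c
}.

Record mulSet (A : pcMonoidType) := MulSet {
  mulset : set A;
  mulset1 : mulset 1;
  mulsetM : forall x y, mulset x -> mulset y -> mulset (x * y)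
}.

Section Localization.
Variables (A : pcMonoidType) (S : mulSet A).

Definition denom := {s : A | `[< mulset S s >]}.

Lemma denomP (s : denom) : mulset S (val s).
Proof. exact/asboolP/(valP s). Qed.

Definition mk_denom (s : A) (Ss : mulset S s) : denom := exist _ s (asboolT Ss).
Definition denom1 : denom := mk_denom (mulset1 S).
Definition denomM (s t : denom) : denom :=
  mk_denom (mulsetM (denomP s) (denomP t)).

Definition loc_rel (x y : A * denom) : bool :=
  `[< exists2 u : A, mulset S u & u * (x.1 * val y.2) = u * (y.1 * val x.2) >].

Lemma loc_rel_refl : reflexive loc_rel.
Proof. by move=> x; apply/asboolP; exists 1 => //; apply: mulset1. Qed.

Lemma loc_rel_sym : symmetric loc_rel.
Proof. by move=> x y; apply/asboolP/asboolP => -[u Su e]; exists u. Qed.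

Lemma loc_rel_trans : transitive loc_rel.
Proof.
move=> [b t] [a s] [c r] /asboolP[u Su /= e1] /asboolP[v Sv /= e2].
apply/asboolP; exists (u * v * val t) => /=.
  by do 2?[apply: mulsetM] => //; apply: denomP.
rewrite [LHS](AC (3*2) ((1*(4*3))*(2*5))) /= e1 [LHS](AC ((1*2)*2) ((4*(2*5))*(1*3))).
by rewrite /= e2 [LHS](AC ((1*2)*2) (4*1*3*(2*5))).
Qed.

Canonical loc_rel_equiv := EquivRel loc_rel loc_rel_refl loc_rel_sym loc_rel_trans.

Definition localization := {eq_quot loc_rel}.
HB.instance Definition _ := Choice.on localization.

Definition frac (a : A) (s : denom) : localization := \pi_localization (a, s).
Definition to_loc (a : A) : localization := frac a denom1.

Lemma frac_eq a s b t : frac a s = frac b t <->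
  exists2 u : A, mulset S u & u * (a * val t) = u * (b * val s).
Proof.
rewrite /frac; split=> [/eqP|e]; first by rewrite piE => /asboolP.
by apply/eqP; rewrite piE; apply/asboolP.
Qed.

Lemma fracW (x : localization) : exists a s, x = frac a s.
Proof. by exists (repr x).1, (repr x).2; rewrite /frac -surjective_pairing reprK. Qed.

Definition loc_mul (x y : localization) : localization :=
  frac ((repr x).1 * (repr y).1) (denomM (repr x).2 (repr y).2).

Lemma loc_mulE a s b t :
  loc_mul (frac a s) (frac b t) = frac (a * b) (denomM s t).
Proof.
rewrite /loc_mul; set x := repr _; set y := repr _.
have /frac_eq[u Su e1] : frac x.1 x.2 = frac a s.
  by rewrite /frac -surjective_pairing reprK.
have /frac_eq[v Sv e2] : frac y.1 y.2 = frac b t.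
  by rewrite /frac -surjective_pairing reprK.
apply/frac_eq; exists (u * v); first exact: mulsetM.
rewrite /= [LHS](AC (2*(2*2)) ((1*(3*5))*(2*(4*6)))) /= e1 e2.
by rewrite [LHS](AC ((1*2)*(1*2)) ((1*4)*((2*5)*(3*6)))).
Qed.

Lemma loc_mulA : associative loc_mul.
Proof.
move=> x y z; have [a [s ->]] := fracW x; have [b [t ->]] := fracW y.
have [c [r ->]] := fracW z; rewrite !loc_mulE; apply/frac_eq.
by exists 1; [exact: mulset1|rewrite /= !mulgA].
Qed.

Lemma loc_mulC : commutative loc_mul.
Proof.
move=> x y; have [a [s ->]] := fracW x; have [b [t ->]] := fracW y.
rewrite !loc_mulE; apply/frac_eq.
by exists 1; [exact: mulset1|rewrite /= [a * b]mulgC [val s * _]mulgC].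
Qed.

Lemma loc_mul1 : left_id (to_loc 1) loc_mul.
Proof.
move=> x; have [a [s ->]] := fracW x; rewrite loc_mulE; apply/frac_eq.
by exists 1; [exact: mulset1|rewrite /= !mul1g].
Qed.

Lemma loc_mulr1 : right_id (to_loc 1) loc_mul.
Proof. by move=> x; rewrite loc_mulC loc_mul1. Qed.

Lemma loc_mul0 : left_zero (to_loc zerog) loc_mul.
Proof.
move=> x; have [a [s ->]] := fracW x; rewrite loc_mulE; apply/frac_eq.
by exists 1; [exact: mulset1|rewrite /= !mul0g].
Qed.

HB.instance Definition _ :=
  isMonoid.Build localization loc_mulA loc_mul1 loc_mulr1.
HB.instance Definition _ :=
  Monoid_isPointedComMonoid.Build localization loc_mulC loc_mul0.

Lemma mul_frac a s b t : frac a s * frac b t = frac (a * b) (denomM s t).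
Proof. exact: loc_mulE. Qed.

Lemma to_locM : {morph to_loc : a b / a * b}.
Proof.
move=> a b; rewrite mul_frac; apply/frac_eq; exists 1; first exact: mulset1.
by rewrite /= !mulg1.
Qed.

End Localization.

Definition prime_compl (A : pcMonoidType) (p : set A) (hp : prime_ideal p) :
  mulSet A.
Proof.
exists (~` p); first exact: prime_ideal1.
by case: hp => _ _ pM x y nx ny /pM[].
Defined.

Definition localization_at (A : pcMonoidType) (p : set A) (hp : prime_ideal p)
  : pcMonoidType := localization (prime_compl hp).

Definition nonzero (A : pcMonoidType) (hA : cancellative A) : mulSet A.
Proof.
exists [set a | a <> zerog]; first exact: cancellative_neq0.
move=> a b a0 b0; rewrite /= -(mulg0 a) => /(cancellative_mulI hA a0).
exact: b0.
Defined.

Definition group_completion (A : pcMonoidType) (hA : cancellative A)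
  : pcMonoidType := localization (nonzero hA).

Definition to_completion (A : pcMonoidType) (hA : cancellative A) :
  A -> group_completion hA := @to_loc A (nonzero hA).

Definition normal_monoid (A : pcMonoidType) : Prop :=
  exists hA : cancellative A,
    forall (b : group_completion hA) (n : nat), (0 < n)%N ->
      range (to_completion hA) (b ^+ n) -> range (to_completion hA) b.

Section Units.
Variable A : pcMonoidType.

Definition units := {x : A | `[< exists y, x * y = 1 >]}.
HB.instance Definition _ := SubChoice.on units.

Definition mk_unit (x : A) (hx : exists y, x * y = 1) : units :=
  exist _ x (asboolT hx).

Lemma unitsP (u : units) : exists y, val u * y = 1.
Proof. exact/asboolP/(valP u). Qed.

Lemma units_one_subproof : exists y : A, 1 * y = 1.
Proof. by exists 1; rewrite mulg1. Qed.

Lemma units_mul_subproof (u v : units) : exists y, val u * val v * y = 1.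
Proof.
have [[x ux] [y vy]] := (unitsP u, unitsP v); exists (x * y).
by rewrite [LHS](AC (2*2) ((1*3)*(2*4))) /= ux vy mulg1.
Qed.

Lemma units_inv_subproof (u : units) : exists y, projT1 (cid (unitsP u)) * y = 1.
Proof. by exists (val u); case: cid => y /= uy; rewrite mulgC. Qed.

Definition units_one : units := mk_unit units_one_subproof.
Definition units_mul (u v : units) : units := mk_unit (units_mul_subproof u v).
Definition units_inv (u : units) : units := mk_unit (units_inv_subproof u).

Lemma units_mulA : associative units_mul.
Proof. by move=> u v w; apply/val_inj; rewrite /= mulgA. Qed.

Lemma units_mul1 : left_id units_one units_mul.
Proof. by move=> u; apply/val_inj; rewrite /= mul1g. Qed.

Lemma units_mulr1 : right_id units_one units_mul.
Proof. by move=> u; apply/val_inj; rewrite /= mulg1. Qed.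

Lemma units_mulrV : right_inverse units_one units_inv units_mul.
Proof. by move=> u; apply/val_inj => /=; case: cid. Qed.

Lemma units_mulV : left_inverse units_one units_inv units_mul.
Proof.
by move=> u; rewrite -[RHS](units_mulrV u); apply/val_inj; rewrite /= mulgC.
Qed.

HB.instance Definition _ :=
  isGroup.Build units units_mulA units_mul1 units_mulr1 units_mulV units_mulrV.

Lemma units_mulC : commutative (@monoid.mul units).
Proof. by move=> u v; apply/val_inj; rewrite /= mulgC. Qed.

Lemma val_unitsM (u v : units) : val (u * v) = val u * val v.
Proof. by []. Qed.

End Units.

Section ValueGroup.
Variables (A : pcMonoidType) (hA : cancellative A).
Local Notation A0 := (group_completion hA).

Lemma completion_unit_subproof (u : units A) :
  exists y, to_completion hA (val u) * y = 1.
Proof.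
have [y uy] := unitsP u; exists (to_completion hA y).
by rewrite -to_locM uy.
Qed.

Definition unit_to_completion (u : units A) : units A0 :=
  mk_unit (completion_unit_subproof u).

Lemma unit_to_completionM : {morph unit_to_completion : u v / u * v}.
Proof. by move=> u v; apply/val_inj; rewrite /= /to_completion to_locM. Qed.

Definition value_rel (x y : units A0) : bool :=
  `[< exists u : units A, y = unit_to_completion u * x >].

Lemma value_rel_refl : reflexive value_rel.
Proof.
move=> x; apply/asboolP; exists 1.
by apply/val_inj; rewrite /= mul1g.
Qed.

Lemma unit_to_completion1 : unit_to_completion 1 = 1.
Proof. exact/val_inj. Qed.

Lemma value_rel_sym : symmetric value_rel.
Proof.
suff h x y : value_rel x y -> value_rel y x by move=> x y; apply/idP/idP; apply: h.
move=> /asboolP[u ->]; apply/asboolP; exists u^-1.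
by rewrite mulgA -unit_to_completionM mulVg unit_to_completion1 mul1g.
Qed.

Lemma value_rel_trans : transitive value_rel.
Proof.
move=> y x z /asboolP[u ->] /asboolP[v ->]; apply/asboolP; exists (v * u).
by rewrite unit_to_completionM mulgA.
Qed.

Canonical value_rel_equiv :=
  EquivRel value_rel value_rel_refl value_rel_sym value_rel_trans.

(* The quotient of the group of units of the group completion (i.e. of its    *)
(* nonzero elements) by the image of the units of A.                           *)
Definition value_group := {eq_quot value_rel}.
HB.instance Definition _ := Choice.on value_group.

Definition value (x : units A0) : value_group := \pi_value_group x.

Lemma value_eq x y :
  value x = value y <-> exists u : units A, y = unit_to_completion u * x.
Proof.
rewrite /value; split=> [/eqP|e]; first by rewrite piE => /asboolP.
by apply/eqP; rewrite piE; apply/asboolP.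
Qed.

Lemma valueW (v : value_group) : exists x, v = value x.
Proof. by exists (repr v); rewrite /value reprK. Qed.

Definition value_mul (v w : value_group) : value_group := value (repr v * repr w).
Definition value_inv (v : value_group) : value_group := value (repr v)^-1.

Lemma value_mulE x y : value_mul (value x) (value y) = value (x * y).
Proof.
have /value_eq[u eu] : value (repr (value x)) = value x by rewrite /value reprK.
have /value_eq[v ev] : value (repr (value y)) = value y by rewrite /value reprK.
apply/value_eq; exists (u * v); rewrite {1}eu {1}ev unit_to_completionM.
by rewrite -!mulgA; congr (_ * _); rewrite !mulgA; congr (_ * _); rewrite units_mulC.
Qed.

Lemma value_invE x : value_inv (value x) = value x^-1.
Proof.
have /value_eq[u eu] : value (repr (value x)) = value x by rewrite /value reprK.
apply/value_eq; exists u^-1; rewrite {1}eu invgM units_mulC; congr (_ * _).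
apply: (mulgI (unit_to_completion u)).
by rewrite mulgV -unit_to_completionM mulgV unit_to_completion1.
Qed.

Lemma value_mulA : associative value_mul.
Proof.
move=> u v w; have [x ->] := valueW u; have [y ->] := valueW v.
by have [z ->] := valueW w; rewrite !value_mulE mulgA.
Qed.

Lemma value_mul1 : left_id (value 1) value_mul.
Proof. by move=> v; have [x ->] := valueW v; rewrite value_mulE mul1g. Qed.

Lemma value_mulr1 : right_id (value 1) value_mul.
Proof. by move=> v; have [x ->] := valueW v; rewrite value_mulE mulg1. Qed.

Lemma value_mulV : left_inverse (value 1) value_inv value_mul.
Proof. by move=> v; have [x ->] := valueW v; rewrite value_invE value_mulE mulVg. Qed.

Lemma value_mulrV : right_inverse (value 1) value_inv value_mul.
Proof. by move=> v; have [x ->] := valueW v; rewrite value_invE value_mulE mulgV. Qed.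

HB.instance Definition _ := isGroup.Build value_group
  value_mulA value_mul1 value_mulr1 value_mulV value_mulrV.

Lemma valueM : {morph value : x y / x * y}.
Proof. by move=> x y; rewrite -value_mulE. Qed.

End ValueGroup.

Definition infinite_cyclic (G : groupType) : Prop :=
  infinite_set [set: G] /\
  exists g : G, forall x : G, exists n : nat, x = g ^+ n \/ x = g ^- n.

(* In the definition below, b is the inverse of a in the group completion.    *)
Definition valuation_monoid (A : pcMonoidType) : Prop :=
  exists hA : cancellative A,
    forall a : group_completion hA, a <> zerog ->
      range (to_completion hA) a \/
      exists2 b, a * b = 1 & range (to_completion hA) b.

Definition discrete_valuation_monoid (A : pcMonoidType) : Prop :=
  valuation_monoid A /\
  exists hA : cancellative A, infinite_cyclic (value_group hA).

(* Main.v *)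
(** Proof idea. Let [B] be the localization of [A] at [p]. If [x, y] are nonzero,
with [y] in [p], then [x] divides a power of [y] in [B]: the complement of a
saturated multiplicative set of a monoid is a prime ideal, and there is no prime
strictly between [{0}] and [p]. Fix a nonzero nonunit [x] of [B]. An ideal
[(x : y)] which is maximal among those with [x] not dividing [y] contains every
nonunit, so that [z = y / x] is not in [B] but maps the maximal ideal [m] into
[B]. If [z m] were contained in [m], the ideals generated by the first terms of
[w, z w, z^2 w, ...] would stabilize, so that some [z^n] would lie in [B], and
[z] as well by normality. Hence [z] maps some [pi] in [m] to a unit, and [m] is
generated by [pi]; every nonzero element is then a unit times a power of [pi]. *)
Require Import Defs.
From mathcomp Require Import all_boot.
From mathcomp Require Import classical_sets.
From mathcomp Require Import boolp cardinality.

Set Implicit Arguments.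
Unset Strict Implicit.
Unset Printing Implicit Defensive.

(** * Divisibility and the ascending chain condition in a monoid *)

Section Divisibility.
Local Open Scope classical_set_scope.
Local Open Scope group_scope.

Definition divides (A : pcMonoidType) (a b : A) : Prop := exists c, b = a * c.

Lemma divides_refl (A : pcMonoidType) (a : A) : divides a a.
Proof. by exists 1; rewrite mulg1. Qed.

Lemma divides_trans (A : pcMonoidType) (b a c : A) :
  divides a b -> divides b c -> divides a c.
Proof. by move=> [d ->] [e ->]; exists (d * e); rewrite mulgA. Qed.

Lemma divides_mulr (A : pcMonoidType) (c a b : A) :
  divides a b -> divides a (b * c).
Proof. by move=> [d ->]; exists (d * c); rewrite mulgA. Qed.

Definition colon (A : pcMonoidType) (x y : A) : set A :=
  [set m | divides x (y * m)].

Lemma ideal_colon (A : pcMonoidType) (x y : A) : ideal (colon x y).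
Proof.
split; first by exists zerog; rewrite !mulg0.
by move=> a m xym; rewrite /colon /= [a * m]mulgC mulgA; apply: divides_mulr.
Qed.

Lemma cancellative_mul_neq0 (A : pcMonoidType) (a b : A) :
  cancellative A -> a <> zerog -> b <> zerog -> a * b <> zerog.
Proof. by move=> hA a0 b0; rewrite -(mulg0 a) => /(cancellative_mulI hA a0). Qed.

Lemma cancellative_expg_neq0 (A : pcMonoidType) (a : A) (n : nat) :
  cancellative A -> a <> zerog -> a ^+ n <> zerog.
Proof.
move=> hA a0; elim: n => [|n IHn]; first exact: cancellative_neq0.
by rewrite expgS; apply: cancellative_mul_neq0.
Qed.

(** If no member were maximal, a choice function would send each member to a strictly larger one,
    and its iterates on [I0] would never stabilize. *)
Lemma noetherian_maximal (A : pcMonoidType) (F : set (set A)) (I0 : set A) :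
  noetherian_monoid A -> (forall I, F I -> ideal I) -> F I0 ->
  exists2 M, F M & forall J, F J -> M `<=` J -> J `<=` M.
Proof.
move=> noeth Fideal FI0; apply: contrapT => nomax.
have /choice[f fP] : forall I, exists J, F I -> [/\ F J, I `<=` J & ~ J `<=` I].
  move=> I; have [FI|] := pselect (F I); last by exists I.
  apply: contrapT => noJ; apply: nomax; exists I => // J FJ IJ.
  by apply: contrapT => nJI; apply: noJ; exists J.
have FI n : F (iter n f I0) by elim: n => //= n /fP[].
have [n|n|N /(_ N.+1 (leqnSn N)) IN] := noeth (fun n => iter n f I0).
- exact: Fideal.
- by have [] := fP _ (FI n).
by have [_ _] := fP _ (FI N); apply; rewrite -[X in X `<=` _]/(iter N.+1 f I0) IN.
Qed.

(** In a monoid a finitely generated ideal is a union of principal ones, so a term lying in the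
    stable ideal is a multiple of a single earlier term. *)
Lemma noetherian_sequence (A : pcMonoidType) (u : nat -> A) :
  noetherian_monoid A -> (forall n, u n <> zerog) ->
  exists n i, (i < n)%N /\ divides (u i) (u n).
Proof.
move=> noeth u0.
pose I n := [set a | a = zerog \/ exists2 i, (i <= n)%N & divides (u i) a].
have [n|n a|N IN] := noeth I.
- split; first by left.
  move=> a x [->|[i le_in ix]]; [left|right]; first by rewrite mulg0.
  by exists i => //; rewrite mulgC; apply: divides_mulr.
- by case=> [->|[i le_in ia]]; [left|right; exists i => //; apply: leqW].
have : I N (u N.+1).
  rewrite -(IN N.+1) //; right; exists N.+1 => //; exact: divides_refl.
by case=> [/u0//|[i le_iN iu]]; exists N.+1, i.
Qed.

End Divisibility.

(** * Existence of a uniformizer and factorization by its powers *)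

Section Uniformizer.
Local Open Scope classical_set_scope.
Local Open Scope group_scope.
Variable A : pcMonoidType.

Definition nonunit (a : A) : Prop := ~ divides a 1.

(** Normality without the completion: if [(a / b)^n] is in [A], so is [a / b]. *)
Definition power_closed : Prop := forall (a b : A) n,
  (0 < n)%N -> b <> zerog -> divides (b ^+ n) (a ^+ n) -> divides b a.

(** Elementwise form of dimension at most one: a prime with a nonzero element contains every
    nonunit. *)
Definition one_dimensional : Prop := forall x y : A,
  x <> zerog -> nonunit y -> exists n, divides x (y ^+ n).

Hypotheses (hA : cancellative A) (noeth : noetherian_monoid A).
Hypotheses (pclosed : power_closed) (dim1 : one_dimensional).

Lemma ex_nonunit_colon (x : A) : x <> zerog -> nonunit x ->
  exists2 y, ~ divides x y & forall m, nonunit m -> divides x (y * m).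
Proof.
move=> x0 nux.
pose F := [set I | exists2 y, ~ divides x y & I = colon x y].
have [||_ [y nxy ->] ymax] := @noetherian_maximal A F (colon x 1) noeth.
- by move=> _ [y _ ->]; apply: ideal_colon.
- by exists 1.
exists y => // m num; have [n xmn] := dim1 x0 num.
(* The least such exponent is positive; for its predecessor [k], the ideal [colon x (y * m ^+ k)] is
   in [F] and contains [m], and maximality puts [m] in [colon x y]. *)
have /ex_minnP[k /asboolP xymk kmin] : exists k, `[< divides x (y * m ^+ k) >].
  by exists n; apply/asboolP; rewrite mulgC; apply: divides_mulr.
case: k xymk kmin => [|k] xymk kmin; first by rewrite expg0 mulg1 in xymk.
suff: colon x y m by [].
apply: (ymax (colon x (y * m ^+ k))) => [|z xyz|].
- by exists (y * m ^+ k) => // /asboolP/kmin; rewrite ltnn.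
- by rewrite /colon /= [y * _ * z](AC (2*1) (1*3*2)) /=; apply: divides_mulr.
- by rewrite /colon /= -mulgA -expgSr.
Qed.

Lemma ex_unit_quotient (x y : A) : x <> zerog -> nonunit x -> ~ divides x y ->
    (forall m, nonunit m -> divides x (y * m)) ->
  exists pi u, [/\ nonunit pi, y * pi = x * u & divides u 1].
Proof.
move=> x0 nux nxy xym; apply: contrapT => nounit.
have y0 : y <> zerog by move=> y0; apply: nxy; exists zerog; rewrite y0 mulg0.
(* If no unit is reached, multiplication by [y / x] maps nonunits to nonunits; [f] is this map, with
   dummy value [m] on units. *)
have /choice[f fP] : forall m, exists m', nonunit m ->
    y * m = x * m' /\ nonunit m'.
  move=> m; have [num|] := pselect (nonunit m); last by exists m.
  have [m' ym] := xym _ num; exists m' => _; split=> // um'.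
  by apply: nounit; exists m, m'.
have nuf n : nonunit (iter n f x) by elim: n => //= n /fP[].
(* For [z = y / x], this is [z^k (z^i x) = z^(i + k) x] with denominators cleared. *)
have yXf k i : y ^+ k * iter i f x = x ^+ k * iter (i + k) f x.
  elim: k => [|k IHk]; first by rewrite !expg0 !mul1g addn0.
  rewrite expgS -mulgA IHk mulgA [y * _]mulgC -mulgA addnS iterS.
  by rewrite (fP _ (nuf _)).1 mulgA -expgSr.
have f0 n : iter n f x <> zerog.
  move=> fn0; have := yXf n 0%N; rewrite add0n fn0 mulg0.
  by apply: cancellative_mul_neq0 => //; apply: cancellative_expg_neq0.
(* A term of the orbit of [x] divides a later one, so [(y / x)^(n - i) = b] is in [A], and [pclosed]
   puts [y / x] in [A]. *)
have [n [i [lt_in [b fn]]]] := noetherian_sequence noeth f0.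
apply: nxy; apply: (pclosed (n := n - i)) => //; first by rewrite subn_gt0.
exists b; apply: (cancellative_mulI hA (f0 i)).
by rewrite [LHS]mulgC yXf subnKC 1?ltnW // fn !mulgA [x ^+ _ * _]mulgC.
Qed.

Lemma ex_uniformizer (x : A) : x <> zerog -> nonunit x ->
  exists pi, [/\ pi <> zerog, nonunit pi & forall m, nonunit m -> divides pi m].
Proof.
move=> x0 nux; have [y nxy xym] := ex_nonunit_colon x0 nux.
have [pi [u [nupi ypi [v uv]]]] := ex_unit_quotient x0 nux nxy xym.
exists pi; split=> // [pi0|m num].
  move: ypi; rewrite pi0 mulg0 => /esym; apply: cancellative_mul_neq0 => // u0.
  by apply: (cancellative_neq0 hA); rewrite uv u0 mul0g.
have y0 : y <> zerog by move=> y0; apply: nxy; exists zerog; rewrite y0 mulg0.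
(* Multiplication by [y / x] sends [pi] to [u] and [m] to [m'], so [m / pi = m' / u = v * m']. *)
have [m' ym] := xym _ num; exists (v * m').
apply: (cancellative_mulI hA y0).
by rewrite ym [RHS]mulgA ypi mulgA -[x * u * v]mulgA -uv mulg1.
Qed.

(** Induction on [n] with [a] dividing [pi ^+ n]: a nonunit [a] is [pi * b], and cancelling [pi]
    makes [b] divide the previous power. *)
Lemma uniformizer_decomposition (pi a : A) : pi <> zerog -> nonunit pi ->
    (forall m, nonunit m -> divides pi m) -> a <> zerog ->
  exists2 u, divides u 1 & exists n, a = u * pi ^+ n.
Proof.
move=> pi0 nupi pim a0; have [n [c an]] := dim1 a0 nupi.
elim: n a c a0 an => [|n IHn] a c a0 an.
  by exists a; [exists c|exists 0%N; rewrite expg0 mulg1].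
have [ua|/pim[b ab]] := pselect (divides a 1).
  by exists a => //; exists 0%N; rewrite expg0 mulg1.
have b0 : b <> zerog by move=> b0; apply: a0; rewrite ab b0 mulg0.
have [|u uu [k bk]] := IHn b c b0.
  by apply: (cancellative_mulI hA pi0); rewrite -expgS an ab mulgA.
by exists u => //; exists k.+1; rewrite ab bk expgS mulgA [pi * u]mulgC mulgA.
Qed.

End Uniformizer.

(** * Valuation property and value group from a uniformizer *)

Section DiscreteValuation.
Local Open Scope classical_set_scope.
Local Open Scope group_scope.
Variables (A : pcMonoidType) (hA : cancellative A) (pi : A).
Hypotheses (pi0 : pi <> zerog) (nupi : nonunit pi).
Hypothesis decomposition : forall a, a <> zerog ->
  exists2 u, divides u 1 & exists n, a = u * pi ^+ n.

Local Notation iota := (to_completion hA).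

Lemma uniformizer_dichotomy (a b : A) : a <> zerog -> b <> zerog ->
  exists2 u, divides u 1 &
    exists n, a = b * (u * pi ^+ n) \/ b = a * (u * pi ^+ n).
Proof.
move=> /decomposition[u [u' uu'] [n ->]] /decomposition[v [v' vv'] [m ->]].
have [le_nm|/ltnW le_mn] := leqP n m.
  exists (v * u'); last exists (m - n)%N.
    by exists (v' * u); rewrite [RHS](AC (2*2) ((1*3)*(4*2))) /= -uu' -vv' mulg1.
  right; rewrite -{1}(subnK le_nm) expgnDr.
  by rewrite [RHS](AC (2*(2*1)) (((1*4)*3)*(5*2))) /= -uu' mul1g mulgA.
exists (u * v'); last exists (n - m)%N.
  by exists (u' * v); rewrite [RHS](AC (2*2) ((1*3)*(4*2))) /= -uu' -vv' mulg1.
left; rewrite -{1}(subnK le_mn) expgnDr.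
by rewrite [RHS](AC (2*(2*1)) (((1*4)*3)*(5*2))) /= -vv' mul1g mulgA.
Qed.

(** The completion is only a monoid, so [x] being the inverse of an image is stated as a product
    equal to [1]. *)
Lemma completion_dichotomy (x : group_completion hA) : x <> zerog ->
  exists2 u, divides u 1 &
    exists n, x = iota (u * pi ^+ n) \/ x * iota (u * pi ^+ n) = 1.
Proof.
have [a [s ->]] := fracW x => as0.
have a0 : a <> zerog.
  move=> a0; apply: as0; apply/frac_eq; exists 1; first exact: mulset1.
  by rewrite a0 !mul0g.
have [u uu [n eas]] := uniformizer_dichotomy a0 (denomP s).
exists u => //; exists n; case: eas => [ea|es]; [left|right].
  apply/frac_eq; exists 1; first exact: mulset1.
  by rewrite /= ea !mul1g !mulg1 mulgC.
rewrite mul_frac; apply/frac_eq; exists 1; first exact: mulset1.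
by rewrite /= -es !mulg1 !mul1g.
Qed.

Lemma dichotomy_valuation : valuation_monoid A.
Proof.
exists hA => x /completion_dichotomy[u uu [n [->|xu]]].
  by left; exists (u * pi ^+ n).
by right; exists (iota (u * pi ^+ n)) => //; exists (u * pi ^+ n).
Qed.

Lemma completion_uniformizer_unit : exists y, iota pi * y = 1.
Proof.
exists (frac 1 (mk_denom (S := nonzero hA) pi0)).
rewrite mul_frac; apply/frac_eq; exists 1; first exact: mulset1.
by rewrite /= !mulg1 !mul1g.
Qed.

Let g : units (group_completion hA) := mk_unit completion_uniformizer_unit.

Lemma val_g_exp n : val (g ^+ n) = iota (pi ^+ n).
Proof.
elim: n => [|n IHn]; first by rewrite !expg0.
by rewrite !expgS val_unitsM IHn /iota to_locM.
Qed.

Lemma value_g_exp n : value (g ^+ n) = value g ^+ n.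
Proof. by elim: n => [|n IHn]; rewrite ?expg0 // !expgS valueM IHn. Qed.

Lemma value_unitM (u : units A) x : value (unit_to_completion hA u * x) = value x.
Proof. by apply/esym/value_eq; exists u. Qed.

Lemma to_completion_inj : injective iota.
Proof.
by move=> a b /frac_eq[u u0]; rewrite /= !mulg1; apply: (cancellative_mulI hA).
Qed.

(** If two powers of [pi] had the same class, cancelling the smaller one would make a positive power
    of [pi] a unit, hence [pi] itself. *)
Lemma value_g_exp_inj : injective (fun n => value g ^+ n).
Proof.
suff lt_neq n m : (n < m)%N -> value g ^+ n <> value g ^+ m.
  move=> n m e; have [/lt_neq//|/lt_neq ne|//] := ltngtP n m.
  by move/esym: e => /ne.
move=> lt_nm; rewrite -!value_g_exp => /value_eq[u /(congr1 val)].
rewrite val_unitsM !val_g_exp /= -[iota (val u) * _]to_locM => /to_completion_inj.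
rewrite -(subnK (ltnW lt_nm)) expgnDr ![_ * pi ^+ n]mulgC.
move=> /(cancellative_mulI hA (cancellative_expg_neq0 hA pi0)) piu.
apply: nupi; have [v <-] := unitsP u; rewrite -piu.
move: lt_nm; rewrite -subn_gt0; case: (m - n)%N => // k _.
by rewrite expgS -mulgA; exists (pi ^+ k * v).
Qed.

Lemma value_group_infinite_cyclic : infinite_cyclic (value_group hA).
Proof.
split.
  move=> /(@finite_preimage _ _ _ (fun n => value g ^+ n)) finN.
  by apply: infinite_nat; apply: finN => n m _ _; apply: value_g_exp_inj.
exists (value g) => w; have [x ->] := valueW w.
have x0 : val x <> zerog.
  move=> x0; have [y] := unitsP x; rewrite x0 mul0g => /frac_eq[u u0].
  rewrite /= !mulg1 mulg0 => u0'; exact: u0.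
have [u [u' uu'] [n eu]] := completion_dichotomy x0; exists n.
(* By the dichotomy [x] or its inverse is [v * g ^+ n], and the unit [v] of [A] has trivial
   class. *)
pose v : units A := mk_unit (ex_intro _ u' (esym uu')).
have uv : iota (u * pi ^+ n) = val (unit_to_completion hA v * g ^+ n).
  by rewrite val_unitsM val_g_exp -to_locM.
have evn : value (unit_to_completion hA v * g ^+ n) = value g ^+ n.
  by rewrite value_unitM value_g_exp.
case: eu; rewrite uv => ex; [left|right].
  by rewrite -evn; congr value; apply: val_inj.
apply/esym/mulg1_eq; rewrite -evn -valueM.
by rewrite units_mulC; congr value; apply: val_inj.
Qed.

Lemma uniformizer_discrete_valuation : discrete_valuation_monoid A.
Proof.
by split; [exact: dichotomy_valuation|exists hA; exact: value_group_infinite_cyclic].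
Qed.

End DiscreteValuation.

(** * Chain condition, cancellation and normality under localization *)

Section LocalizationProperties.
Local Open Scope classical_set_scope.
Local Open Scope group_scope.

(** The contractions to [A] form a stationary chain, and they determine the ideals of the
    localization, as [a / s] and [a / 1] differ by the unit [s / 1]. *)
Lemma localization_noetherian (A : pcMonoidType) (S : mulSet A) :
  noetherian_monoid A -> noetherian_monoid (localization S).
Proof.
move=> noeth I Iideal Iincr.
have [n|n a|N IN] := noeth (fun n => [set a | I n (to_loc S a)]).
- have [I0 IM] := Iideal n; split=> // a x Ix.
  by rewrite /= to_locM; apply: IM.
- exact: Iincr.
have fracI n a s : I n (frac a s) = I n (to_loc S a).
  have [_ IM] := Iideal n; apply/propext; split=> [/(IM (to_loc S (val s)))|/(IM (frac 1 s))].
    rewrite mul_frac; congr (I n _); apply/frac_eq.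
    by exists 1; [exact: mulset1|rewrite /= mulg1 !mul1g mulgC].
  rewrite mul_frac; congr (I n _); apply/frac_eq.
  by exists 1; [exact: mulset1|rewrite /= mulg1 !mul1g].
exists N => n le_Nn; apply/funext => x; have [a [s ->]] := fracW x.
by rewrite !fracI -[RHS]/([set b | I N (to_loc S b)] a) -(IN n).
Qed.

Variables (A : pcMonoidType) (hA : cancellative A).

Lemma normal_power_closed : normal_monoid A -> power_closed A.
Proof.
move=> [hA' normA] a b n n0 b0 [c anc].
pose s := mk_denom (S := nonzero hA') b0.
have fracX k : frac a s ^+ k * to_completion hA' (b ^+ k) =
    to_completion hA' (a ^+ k).
  elim: k => [|k IHk]; first by rewrite !expg0 mul1g.
  rewrite !expgS /to_completion !to_locM [LHS](AC (2*2) ((2*4)*(1*3))) /=.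
  rewrite IHk mulgC; congr (_ * _); rewrite mul_frac; apply/frac_eq.
  by exists 1; [exact: mulset1|rewrite /= !mulg1].
have [|d _ /frac_eq[u u0]] := normA (frac a s) n n0.
  exists c => //.
  (* Multiplying by the inverse [t] of [b ^+ n] turns [a ^+ n = b ^+ n * c] into [(a / b)^n = c]. *)
  have [t tb] : exists t, to_completion hA' (b ^+ n) * t = 1.
    exists (frac 1 (mk_denom (S := nonzero hA') (cancellative_expg_neq0 (n := n) hA' b0))).
    rewrite mul_frac; apply/frac_eq; exists 1; first exact: mulset1.
    by rewrite /= !mulg1 !mul1g.
  rewrite -[LHS]mulg1 -[RHS]mulg1 -tb !mulgA fracX anc /to_completion to_locM.
  by rewrite [_ * to_loc _ c]mulgC.
rewrite /= mulg1 => e; exists d; rewrite mulgC.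
exact/esym/(cancellative_mulI hA' u0).
Qed.

Variable S : mulSet A.
Hypothesis S0 : ~ mulset S zerog.

Lemma mulset_neq0 s : mulset S s -> s <> zerog.
Proof. by move=> Ss s0; apply: S0; rewrite -s0. Qed.

Lemma cancellative_frac_eq a s b t :
  frac (S := S) a s = frac b t <-> a * val t = b * val s.
Proof.
split=> [/frac_eq[u Su]|e]; first exact/cancellative_mulI/mulset_neq0.
by apply/frac_eq; exists 1; [exact: mulset1|rewrite e].
Qed.

Lemma frac_eq0 a s : frac (S := S) a s = zerog <-> a = zerog.
Proof. by rewrite cancellative_frac_eq /= mul0g mulg1. Qed.

Lemma localization_cancellative : cancellative (localization S).
Proof.
split=> [/frac_eq0|x y z]; first exact: cancellative_neq0.
have [a [s ->]] := fracW x; have [b [t ->]] := fracW y; have [c [r ->]] := fracW z.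
move=> /frac_eq0 a0; rewrite !mul_frac => /cancellative_frac_eq /= e.
apply/cancellative_frac_eq; apply: (cancellative_mulI hA a0).
apply: (cancellative_mulI hA (mulset_neq0 (denomP s))).
by rewrite [LHS](AC (1*(1*2)) ((2*3)*(1*4))) /= e [LHS](AC (2*2) (3*(1*(2*4)))).
Qed.

Lemma frac_divides a s b t : divides (frac (S := S) a s) (frac b t) <->
  exists2 u, mulset S u & divides a (b * u).
Proof.
split=> [[x]|[u Su [c bu]]].
  have [c [r ->]] := fracW x; rewrite mul_frac => /cancellative_frac_eq /= e.
  exists (val s * val r); first by apply: mulsetM; apply: denomP.
  by exists (c * val t); rewrite e mulgA.
exists (frac (c * val s) (denomM t (mk_denom Su))).
rewrite mul_frac; apply/cancellative_frac_eq => /=.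
by rewrite [LHS](AC (1*(1*2)) ((1*4)*(2*3))) /= bu [LHS](AC (2*2) ((1*(2*3))*4)).
Qed.

Lemma exp_frac a s n :
  exists t, frac (S := S) a s ^+ n = frac (a ^+ n) t.
Proof.
elim: n => [|n [t IHn]]; first by exists (denom1 S).
by exists (denomM s t); rewrite !expgS IHn mul_frac.
Qed.

(** If [b^n] divides [a^n * u] with [u] in [S], it divides [(a * u)^n] too, since [n > 0]; hence [b]
    divides [a * u]. *)
Lemma localization_power_closed :
  power_closed A -> power_closed (localization S).
Proof.
move=> pclosed x y [//|n] _; have [a [s ->]] := fracW x.
have [b [t ->]] := fracW y; have [s' ->] := exp_frac a s n.+1.
have [t' ->] := exp_frac b t n.+1 => bt0 /frac_divides[u Su abu].
apply/frac_divides; exists u => //.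
apply: (pclosed _ _ n.+1) => //; first by move=> b0; apply/bt0/frac_eq0.
by rewrite expgMn; [rewrite [u ^+ _]expgS mulgA; apply: divides_mulr|exact: mulgC].
Qed.

End LocalizationProperties.

(** * Height one primes and the dimension of the localization *)

Section HeightOne.
Local Open Scope classical_set_scope.
Local Open Scope group_scope.
Variables (A : pcMonoidType) (hA : cancellative A) (p : set A).
Hypotheses (hp : prime_ideal p) (htp : has_height p 1).

Lemma prime_ideal0 : prime_ideal [set zerog : A].
Proof.
split=> [|A0|x y /= xy0].
- by split=> // a x /= ->; rewrite mulg0.
- by apply: (cancellative_neq0 hA); rewrite -[_ = _]/([set zerog] 1) A0.
have [x0|x0] := pselect (x = zerog); [by left|right].
by apply: (cancellative_mulI hA x0); rewrite mulg0.
Qed.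

Lemma height1_ex_neq0 : exists2 x, p x & x <> zerog.
Proof.
apply: contrapT => nox; have [ub lub] := htp.
(* Without a chain of length 1, truncation excludes all longer ones, and [0] bounds the lengths,
   against 1 being the least bound. *)
have [q [q0 qprime /(_ 0%N isT)[q1q0 nq0q1]]] : prime_chain p 1.
  apply: contrapT => nch1.
  suff : (1 <= 0)%N by [].
  apply: (lub 0%N) => -[//|n] [q [q0 qprime qlt]]; case: nch1; exists q; split=> // i le_i1.
    by apply: qprime; apply: leq_trans le_i1 _.
  by apply: qlt; apply: leq_trans le_i1 _.
apply: nq0q1 => x; rewrite q0 => px.
have -> : x = zerog by apply: contrapT => x0; apply: nox; exists x.
by have [[]] := qprime 1%N isT.
Qed.

Lemma height1_minimal (q : set A) :
  prime_ideal q -> q `<` p -> q `<=` [set zerog].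
Proof.
move=> qprime ltqp x qx; apply: contrapT => /= x0; have [ub _] := htp.
suff /ub : prime_chain p 2 by [].
(* The chain [p], [q], [{0}], whose last step is strict because [q] contains the nonzero [x]. *)
exists (fun i => if i is i'.+1 then if i' is 0%N then q else [set zerog] else p).
split=> // [[|[|[|i]]]|[|[|i]]] //= _; first exact: prime_ideal0.
split=> [y /= ->|/(_ _ qx)//].
by case: qprime => -[].
Qed.

(* The prime of the argument is the complement of the saturated multiplicative
   set generated by [y] and the complement of [p]. *)
Lemma height1_divides (x y : A) : x <> zerog -> p y -> y <> zerog ->
  exists n s, ~ p s /\ divides x (y ^+ n * s).
Proof.
move=> x0 py y0; apply: contrapT => nox.
pose q := [set z | ~ exists n s, ~ p s /\ divides z (y ^+ n * s)].
have [[p0 pM] _ pprime] := hp.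
have np1 := prime_ideal1 hp.
(* By [nox], [x] is in [q]; once [q] is a prime strictly inside [p], minimality forces [x = 0]. *)
apply: x0; apply: (@height1_minimal q) => //.
  split=> [||z w].
  - split=> [[n [s [nps [c]]]]|a z nz [n [s [nps zs]]]].
      rewrite mul0g; apply: cancellative_mul_neq0 => //.
        exact: cancellative_expg_neq0.
      by move=> s0; apply: nps; rewrite s0.
    apply: nz; exists n, s; split=> //; apply: divides_trans zs.
    by rewrite mulgC; apply/divides_mulr/divides_refl.
  - move=> qT; have : q 1 by rewrite qT.
    by apply; exists 0%N, 1; split=> //; rewrite expg0 mulg1; apply: divides_refl.
  move=> qzw; have [|/contrapT[n [s [nps [c zs]]]]] := pselect (q z); first by left.
  right=> -[m [t [npt [d wt]]]]; apply: qzw; exists (n + m)%N, (s * t); split.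
    by move=> /pprime[].
  exists (c * d); rewrite expgnDr [LHS](AC (2*2) ((1*3)*(2*4))) /= zs wt.
  by rewrite [LHS](AC (2*2) ((1*3)*(2*4))).
split=> [z qz|pq].
  apply: contrapT => npz; apply: qz; exists 0%N, z; split=> //.
  by rewrite expg0 mul1g; apply: divides_refl.
apply: (pq _ py); exists 1%N, 1; split=> //.
by rewrite mulg1; apply: divides_refl.
Qed.

Lemma prime_compl_neq0 : ~ mulset (prime_compl hp) zerog.
Proof. by apply; case: hp => -[]. Qed.

Lemma nonunit_frac a s : nonunit (frac (S := prime_compl hp) a s) <-> p a.
Proof.
split=> [nu|pa /(frac_divides hA prime_compl_neq0)[u nu [c cu]]].
  apply: contrapT => npa; apply: nu.
  apply/(frac_divides hA prime_compl_neq0); exists a => //.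
  by exists 1; rewrite mulgC.
by apply: nu; rewrite -[u]mul1g cu mulgC; case: hp => -[_ pM] _ _; apply: pM.
Qed.

Lemma height1_one_dimensional : one_dimensional (localization (prime_compl hp)).
Proof.
move=> x y; have [a [s ->]] := fracW x; have [b [t ->]] := fracW y.
move=> as0 /nonunit_frac pb.
have a0 : a <> zerog by move=> /(frac_eq0 hA prime_compl_neq0 _ s).
have [b0|b0] := pselect (b = zerog).
  (* The exponent must be positive: [y^0 = 1], whereas [y^1 = 0] is a multiple of everything. *)
  exists 1%N; exists zerog; rewrite mulg0.
  exact/(frac_eq0 hA prime_compl_neq0).
have [n [u [npu abu]]] := height1_divides a0 pb b0; exists n.
have [t' ->] := exp_frac b t n.
by apply/(frac_divides hA prime_compl_neq0); exists u.
Qed.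

End HeightOne.

Theorem corollary2p6 (A : pcMonoidType) (p : set A) (hp : prime_ideal p) :
  noetherian_monoid A -> normal_monoid A -> has_height p 1 ->
  discrete_valuation_monoid (localization_at hp).
Proof.
move=> noeth normA htp; have [hA _] := normA.
have S0 := prime_compl_neq0 (hp := hp).
have hB := localization_cancellative hA S0.
have noethB := localization_noetherian (S := prime_compl hp) noeth.
have pclosedB := localization_power_closed hA S0 (normal_power_closed normA).
have dimB := height1_one_dimensional hA (hp := hp) htp.
(* A nonzero element of [p] becomes a nonzero nonunit of the localization, which starts the
   construction of the uniformizer. *)
have [x px x0] := height1_ex_neq0 htp.
have xB0 : to_loc (prime_compl hp) x <> zerog by move=> /(frac_eq0 hA S0).
have [pi [pi0 nupi pim]] := ex_uniformizer hB noethB pclosedB dimB xB0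
  ((nonunit_frac hA x _).2 px).
apply: (uniformizer_discrete_valuation hB pi0 nupi) => a a0.
exact: (uniformizer_decomposition hB dimB).
Qed.
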